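(* Let $n\ge 3$ and $a\ge 1$ be integers, $F$ a field, and $R=F[x_1,\dots,x_n]/(x_1^a)$. Let $L_1$ and $L_2$ be two nonempty lexsegment sets of monomials in $R_t$ with sizes $b$ and $c$ respectively, where $b\ge c$. Let $j_1=I(L_1)$ and $j_2=I(L_2)$ (so $j_1\le j_2$). Define $$t'=\begin{cases} t-j_2 & \text{if } j_1=j_2,\ j_1\ne a-1 \text{ and } x_1^{j_1}x_n^{t-j_1}\notin L_1\cup L_2,\\ t+1-j_2 & \text{otherwise.}\end{cases}$$ Then $$b_{n,t}+c_{n,t}>(b+c)_{n,t+t'}.$$
   Context: All variables have degree $1$ and $R_t$ is the homogeneous component of degree $t$ of $R$. The monomials in $R_t$ are the monomials of degree $t$ in $F[x_1,\dots,x_n]$ not divisible by $x_1^a$, ordered lexicographically with $x_1>\dots>x_n$. A set $L$ of monomials in $R_t$ is lexsegment if whenever $m\in L$ and $v$ is a monomial in $R_t$ with $v>m$, then $v\in L$. For a set $M$ of monomials in $R_t$, $R_1\cdot M$ is the set of monomials $x_im$ ($1\le i\le n$, $m\in M$) that are nonzero in $R$, i.e. not divisible by $x_1^a$. For a nonempty set $M$ of monomials in $R_t$, $I(M)$ is the smallest integer $i$ such that $M$ contains a monomial divisible by $x_1^i$ but not by $x_1^{i+1}$. For a positive integer $d$, $d_{n,t}$ denotes $|R_1\cdot L|$, where $L$ is the lexsegment set of $d$ monomials in $R_t$. It is defined only when $d$ is at most the number of monomials in $R_t$, and this is always assumed when $d_{n,t}$ is written (in particular for $(b+c)_{n,t+t'}$).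 *)

(* Defs.v *)
(* MathComp (multinomials, finmap), with classical decidability from boolp. *)
From mathcomp Require Import all_boot all_order all_algebra.
From mathcomp Require Import finmap mpoly.
From mathcomp Require Import boolp.

Set Implicit Arguments.
Unset Strict Implicit.
Unset Printing Implicit Defensive.

Import Order.TTheory GRing.Theory.

Local Open Scope fset_scope.

(* The polynomial ring has n.+1 variables: x_1 is 'X_ord0 and the last
   variable is 'X_ord_max.  A monomial is given by its exponent vector
   m : 'X_{1..n.+1}, the corresponding polynomial being 'X_[m].               *)

(* The class of p in R = F[x_1, ..., x_(n+1)] / (x_1 ^ a) is nonzero, that is,
   p is not in the ideal generated by x_1 ^ a.                                *)
Definition nonzero_in_R (F : fieldType) (n a : nat) (p : {mpoly F[n.+1]}) :
    bool :=
  ~~ `[< exists q : {mpoly F[n.+1]}, p = (q * 'X_ord0 ^+ a)%R >].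

Definition monomials_in_R (F : fieldType) (n a t : nat) :
    {fset 'X_{1..n.+1}} :=
  [fset m in [fset bmnm m | m : 'X_{1..n.+1 < t.+1}]
     | (mdeg m == t) && nonzero_in_R a 'X_[F, m]].

(* The library order on exponent vectors compares degrees first and then
   exponents lexicographically from the first variable on, so within one degree
   it is the lexicographic order with x_1 > x_2 > ...; see ltmcP.             *)
Definition lexsegment (F : fieldType) (n a t : nat) (L : {fset 'X_{1..n.+1}}) :
    Prop :=
  L `<=` monomials_in_R F n a t /\
  (forall m v : 'X_{1..n.+1}, m \in L -> v \in monomials_in_R F n a t ->
     (m < v)%O -> v \in L).

(* R_1 . M *)
Definition R1mul (F : fieldType) (n a : nat) (M : {fset 'X_{1..n.+1}}) :
    {fset 'X_{1..n.+1}} :=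
  [fset u in [fset (U_(i) + m)%MM | i in 'I_n.+1, m in M]
     | nonzero_in_R a 'X_[F, u]].

(* The d largest monomials of R_t.  For d at most the number of monomials of
   R_t this is the unique lexsegment set of size d, by lexseg_ofP and
   lexseg_of_uniq; for larger d it is a junk value.                           *)
Definition lexseg_of (F : fieldType) (n a t d : nat) : {fset 'X_{1..n.+1}} :=
  [fset m in take d (sort >=%O (monomials_in_R F n a t))].

(* d_{n,t}, in n.+1 variables *)
Definition growth (F : fieldType) (n a t d : nat) : nat :=
  #|` R1mul F a (lexseg_of F n a t d)|.

(* j = I(M) *)
Definition is_I (n : nat) (M : {fset 'X_{1..n.+1}}) (j : nat) : Prop :=
  let attained i := exists m : 'X_{1..n.+1},
    [/\ m \in M, (U_(ord0) *+ i <= m)%MM & ~~ (U_(ord0) *+ i.+1 <= m)%MM] in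
  attained j /\ (forall i, attained i -> j <= i).

Lemma nonzero_in_RE (F : fieldType) (n a : nat) (m : 'X_{1..n.+1}) :
  nonzero_in_R a 'X_[F, m] = (m ord0 < a).
Proof.
rewrite ltnNge /nonzero_in_R; congr negb; apply/asboolP/idP.
  case=> q Eq; have: m \in msupp (q * 'X_[F, (U_(ord0) *+ a)%MM])%R.
    by rewrite -mpolyXn -Eq msuppX inE.
  rewrite (perm_mem (msuppMX _ _)) => /mapP[u _ ->].
  by rewrite mnmDE mulmnE mnm1E eqxx mul1n leq_addr.
move=> le_am; exists 'X_[F, (m - U_(ord0) *+ a)%MM].
rewrite mpolyXn -mpolyXD submK //; apply/mnm_lepP => i.
by rewrite mulmnE mnm1E; case: eqP => [<-|_]; rewrite ?mul1n.
Qed.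

Lemma in_monomials_in_R (F : fieldType) (n a t : nat) (m : 'X_{1..n.+1}) :
  (m \in monomials_in_R F n a t) =
  (mdeg m == t) && nonzero_in_R a 'X_[F, m].
Proof.
rewrite !inE /=; case: eqP => [mt|]; last by rewrite andbF.
rewrite andb_idl // => _; apply/imfsetP.
have lt_mt : mdeg m < t.+1 by rewrite mt.
by exists (BMultinom lt_mt).
Qed.

Section LexsegOf.
Variables (F : fieldType) (n a t : nat).
Let Rt := monomials_in_R F n a t.
Let s := sort >=%O Rt.

Local Lemma s_sorted : sorted >%O s.
Proof.
have -> : sorted >%O s = sorted <%O (rev s) by rewrite rev_sorted.
rewrite lt_sorted_uniq_le rev_uniq sort_uniq fset_uniq rev_sorted /=.
by apply: sort_sorted => x y; apply: le_total.
Qed.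

Local Lemma s_uniq : uniq s.
Proof. by rewrite sort_uniq fset_uniq. Qed.

Local Lemma mem_s : s =i Rt.
Proof. by move=> m; rewrite mem_sort. Qed.

Local Lemma mem_lexseg_of d (m : 'X_{1..n.+1}) :
  m \in s -> (m \in lexseg_of F n a t d) = (index m s < d).
Proof. by move=> ms; rewrite !inE /= in_take. Qed.

Local Lemma index_s (m v : 'X_{1..n.+1}) :
  m \in s -> v \in s -> (m < v)%O -> index v s < index m s.
Proof.
move=> ms vs; apply: contraTT; rewrite -leqNgt -leNgt => le_mv.
have [->//|ne] := eqVneq m v.
have lt_ix : index m s < index v s.
  rewrite ltn_neqAle le_mv andbT; apply: contraNneq ne => eq_ix.
  by rewrite -(nth_index m ms) eq_ix nth_index.
apply: ltW; have gt_trans : transitive (>%O : rel 'X_{1..n.+1}).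
  by move=> x y z /= h1 h2; apply: lt_trans h2 h1.
have := sorted_ltn_nth gt_trans m s_sorted (index m s) (index v s).
by rewrite !inE !index_mem => /(_ ms vs lt_ix) /=; rewrite !nth_index.
Qed.

Lemma lexseg_ofP d : d <= #|` Rt| ->
  lexsegment F a t (lexseg_of F n a t d) /\ #|` lexseg_of F n a t d| = d.
Proof.
move=> le_d; split; last first.
  rewrite card_fseq undup_id ?take_uniq ?s_uniq //.
  by rewrite size_takel // size_sort.
have sub : lexseg_of F n a t d `<=` Rt.
  apply/fsubsetP => m mL; rewrite -mem_s.
  by move: mL; rewrite !inE /=; apply: mem_take.
split=> // m v mL vR lt_mv.
have ms : m \in s by rewrite mem_s (fsubsetP sub).
have vs : v \in s by rewrite mem_s.
rewrite (mem_lexseg_of _ vs) (ltn_trans (index_s ms vs lt_mv)) //.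
by rewrite -mem_lexseg_of.
Qed.

Lemma lexseg_of_uniq (L : {fset 'X_{1..n.+1}}) :
  lexsegment F a t L -> L = lexseg_of F n a t #|` L|.
Proof.
move=> [LR Lup]; apply/eqP.
have cLR := fsubset_leq_card LR.
have [[L'R L'up] cL'] := lexseg_ofP cLR.
set L' := lexseg_of _ _ _ _ _ in L'R L'up cL' *.
have [sub|] := boolP (L `<=` L'); first by rewrite eqEfcard sub cL' leqnn.
case/fsubsetPn=> m mL mL'.
have : L' `<=` L.
  apply/fsubsetP => v vL'; apply: contraNT mL' => vL.
  have vR := fsubsetP L'R _ vL'; have mR := fsubsetP LR _ mL.
  have [lt|lt|E] := ltgtP m v; first by rewrite (Lup m) in vL.
  - exact: (L'up v).
  by rewrite E.
by move=> sub; rewrite eq_sym eqEfcard sub cL' leqnn.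
Qed.

End LexsegOf.

(* Main.v *)
Require Import Defs.
From mathcomp Require Import all_boot all_order all_algebra.
From mathcomp Require Import finmap mpoly zify.

(** Listing the monomials of R_t in decreasing order and adding them one at a
    time to a lexsegment set L, the monomial m contributes to R_1 . L exactly
    the products x_i m that are nonzero in R and in which x_i is the last
    variable: any other x_i m equals x_j m' with x_j its last variable and
    m' > m already in L.  Hence d_{n,t} is the sum of the first d letters of a
    word of weights attached to R_t ([growthE]), and the proposition is an
    inequality between prefix sums of such words.

    Grouped by the power of x_1, the monomials of R_t are
    x_1^i S_{t-i} for i = min(a - 1, t), ..., 1, 0, where S is the polynomial
    ring in x_2, ..., x_n.  The weight word is therefore, for t >= a - 1, the
    concatenation V_{t-a+1} V_{t-a+2} ... V_t of the weight words of the
    homogeneous components of S, and V_m is a prefix of V_{m+1}.  When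
    t < a - 1 the word starts instead with the weight n of x_1^t.

    The main point is that all these words are front loaded: among all windows
    of a given length, the initial one has the largest sum and the final one
    the smallest.  Both halves are needed together in order to pass to a
    concatenation: a window straddling w ++ x is a suffix of w followed by a
    prefix of x, and exchanging the two parts uses the final window of w and
    the initial window of x ([front_loaded_cat]).  Induction on the number of
    variables then gives the property for all weight words, in particular the
    subadditivity f(b + c) <= f(b) + f(c) of their prefix sums f.

    Strictness comes from the first letter, and uses that S has n - 1 >= 2
    variables.  The word V_m begins with the weight of x_2^m; truncating S by
    x_2^(m+1) takes away the product x_2 x_2^m, so it lowers this letter by one,
    leaves the others unchanged, and produces again a front loaded word.  Hence
    the prefix sums of V_m are strictly subadditive ([psum_words_lt]).

    To conclude, put s = t - a + 1 >= 0 (the case t < a - 1 is similar and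
    simpler), so that both L_1 and L_2 begin inside V_s.  The word of R_{t+t'}
    begins with V_{s+t'}, and the definition of t' always gives t' >= s + 1,
    so that V_{s+t'} is at least twice as long as V_s (again as n >= 3).  Cut b and c at the
    length of V_s.  The two initial parts fit together inside V_{s+t'}, where
    subadditivity is strict; the remaining parts are compared by
    subadditivity and by the fact that the word V_{s+t'} V_{s+t'+1} ... is
    dominated by V_{s+1} V_{s+2} ..., being a window of the latter. *)

Set Implicit Arguments.
Unset Strict Implicit.
Unset Printing Implicit Defensive.

Import Order.TTheory Order.DefaultSeqLexiOrder.

(** * Prefix sums and front loaded words *)

Definition psum (w : seq nat) (i : nat) : nat := sumn (take i w).

Lemma psum0 w : psum w 0 = 0.
Proof. by rewrite /psum take0. Qed.

Lemma psum_cat w x i : psum (w ++ x) i = psum w i + psum x (i - size w).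
Proof.
rewrite /psum take_cat; case: ltnP => [lt_iw|le_wi].
  by rewrite (eqP (ltnW lt_iw)) take0 addn0.
by rewrite sumn_cat (take_oversize le_wi).
Qed.

Lemma psum_oversize w i : size w <= i -> psum w i = psum w (size w).
Proof. by move=> le_wi; rewrite /psum take_size take_oversize. Qed.

Lemma psum_minn w i : psum w (minn i (size w)) = psum w i.
Proof. by case: leqP => // /ltnW /psum_oversize. Qed.

Lemma psum_prefix w x i : prefix w x -> i <= size w -> psum x i = psum w i.
Proof.
by case/prefixP=> y -> le_iw; rewrite psum_cat (eqP le_iw) psum0 addn0.
Qed.

(** Both clauses are about windows of [w]: the initial window of length [d]
    dominates the one that starts at [p], and the final window, which starts at
    [q], is dominated by the one of the same length that runs from [p] to
    [r].  Prefix sums are constant past the end of the word, which lets the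
    first clause hold for windows that overrun it. *)
Definition front_loaded (w : seq nat) : Prop :=
  (forall p d, psum w (p + d) <= psum w p + psum w d) /\
  (forall p q r, p <= q -> p <= r -> q + r = p + size w ->
     psum w (size w) + psum w p <= psum w q + psum w r).

Lemma front_loaded1 x : front_loaded [:: x].
Proof.
have E i : psum [:: x] i = (0 < i) * x by case: i => //= i; rewrite mul1n /psum /= addn0.
split=> [p d|p q r le_pq le_pr /= eq_qr]; rewrite !E -!mulnDl leq_mul2r.
  by case: p d => [|p] [|d]; rewrite orbT.
by apply/orP; right; lia.
Qed.

(** A window straddling the two words is a suffix of [w] followed by a prefix of
    [x].  To bound it by an initial window, replace the suffix by an earlier
    window of [w] of the same length, and move the prefix of [x] to the front,
    where [w] is at least as large; final windows are treated dually. *)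
Lemma front_loaded_cat w x : front_loaded w -> front_loaded x ->
    (forall i, i <= size w -> psum x i <= psum w i) ->
    (forall d, d <= size w -> d <= size x ->
       psum x (size x) + psum w (size w - d)
         <= psum w (size w) + psum x (size x - d)) ->
  front_loaded (w ++ x).
Proof.
move=> [subw supw] [subx supx] prefix_le suffix_le; split=> [p d|].
  rewrite !psum_cat; set N := size w in supw prefix_le suffix_le *.
  have [le_pdN|lt_Npd] := leqP (p + d) N.
    by rewrite (eqP le_pdN) psum0 addn0; have := subw p d; lia.
  rewrite (psum_oversize (ltnW lt_Npd)) -/N.
  wlog le_pd : p d lt_Npd / p <= d.
    by move=> W; case: (leqP p d) => [|/ltnW] /W; rewrite 1?addnC; lia.
  have [le_dN|lt_Nd] := leqP d N.
    have := supw (p + d - N) p d.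
    have := prefix_le (p + d - N).
    have -> : d - N = 0 by lia.
    have -> : p - N = 0 by lia.
    rewrite psum0; lia.
  rewrite (psum_oversize (ltnW lt_Nd)) -/N.
  have [le_pN|lt_Np] := leqP p N.
    have := subx p (d - N); have := prefix_le p le_pN.
    have -> : p + (d - N) = p + d - N by lia.
    have -> : p - N = 0 by lia.
    rewrite psum0; lia.
  rewrite (psum_oversize (ltnW lt_Np)) -/N.
  have := subx (p - N) d; have := subx (d - N) N.
  have := prefix_le N (leqnn _).
  have -> : p - N + d = p + d - N by lia.
  have -> : d - N + N = d by lia.
  lia.
move=> p q r le_pq le_pr; rewrite size_cat !psum_cat.
set N := size w in supw prefix_le suffix_le *.
set M := size x in supx suffix_le *.
rewrite (@psum_oversize w (N + M)) ?leq_addr // -/N addKn.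
wlog le_qr : q r le_pq le_pr / q <= r.
  move=> W; case: (leqP q r) => [|/ltnW] le eq_qr; first exact: W.
  by rewrite [leqRHS]addnC; apply: W; lia.
move=> eq_qr.
have [le_Nq|lt_qN] := leqP N q.
  rewrite (psum_oversize le_Nq) (psum_oversize (leq_trans le_Nq le_qr)) -/N.
  have [le_Np|lt_pN] := leqP N p.
    rewrite (psum_oversize le_Np) -/N.
    by have := supx (p - N) (q - N) (r - N); lia.
  have -> : p - N = 0 by lia.
  rewrite psum0.
  have := suffix_le (N - p); have := subx (q - N) (r - N).
  have -> : q - N + (r - N) = M - (N - p) by lia.
  have -> : N - (N - p) = p by lia.
  lia.
have -> : q - N = 0 by lia.
have -> : p - N = 0 by lia.
rewrite psum0.
have [le_Nr|lt_rN] := leqP N r.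
  rewrite (psum_oversize le_Nr) -/N.
  have := suffix_le (q - p); have := supw p q (N - (q - p)).
  have -> : M - (q - p) = r - N by lia.
  lia.
have -> : r - N = 0 by lia.
rewrite psum0.
have := supw p q (r - M); have := suffix_le M; have := supw (r - M) r (N - M).
rewrite subnn psum0; lia.
Qed.

(** * The weight words *)

(** The weight word of R_t when [v m] is that of the degree [m] component in the
    variables other than x_1.  The recursion separates the monomials divisible
    by x_1, which form a copy of the degree [t - 1] component for the exponent
    bound [a - 1], from the others.  In degree 0 the remaining monomial
    represents a power of x_1, and it has x_1 as an additional new multiplier
    unless that power is the (a-1)-st of the initial ring. *)
Fixpoint trunc_word (v : nat -> seq nat) (a t : nat) : seq nat :=
  match a, t with
  | 0, _ => [::]
  | a'.+1, 0 => [seq (0 < a') + x | x <- v 0]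
  | a'.+1, t'.+1 => trunc_word v a' t' ++ v t
  end.

(** The weight word of the degree [m] monomials in [k] variables; the bound
    [m.+2] on the exponent of the first variable is vacuous even after one more
    multiplication by it. *)
Fixpoint words (k m : nat) : seq nat :=
  if k is k'.+1 then trunc_word (words k') m.+2 m
  else if m is 0 then [:: 0] else [::].

Definition block_family (v : nat -> seq nat) : Prop :=
  [/\ forall m, front_loaded (v m), forall m, prefix (v m) (v m.+1)
    & size (v 0) = 1].

Lemma block_family_prefix v m m' :
  block_family v -> m <= m' -> prefix (v m) (v m').
Proof.
move=> [_ pre _] /subnKC <-; elim: (m' - m) => [|i IH].
  by rewrite addn0 prefix_refl.
by rewrite addnS; apply: prefix_trans IH (pre _).
Qed.

Lemma psum_block v m m' i : block_family v -> m <= m' -> i <= size (v m) ->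
  psum (v m') i = psum (v m) i.
Proof. by move=> fv le_mm; apply/psum_prefix/block_family_prefix. Qed.

Lemma leq_size_block v m m' :
  block_family v -> m <= m' -> size (v m) <= size (v m').
Proof. by move=> fv le; apply/size_prefix/block_family_prefix. Qed.

(** Once the prefix reaches past the recursive part of the word, cut it there and
    use subadditivity of [v m]: the second piece becomes a prefix of the last
    block. *)
Lemma trunc_word_prefix_max v a t m i : block_family v -> t <= m ->
  i <= size (trunc_word v a t) -> psum (v m) i <= psum (trunc_word v a t) i.
Proof.
move=> fv; have [good _ v0] := fv.
elim: a t m i => [|a IH] [|t] m i le_tm; rewrite /= ?leqn0.
- by move/eqP->; rewrite psum0.
- by move/eqP->; rewrite psum0.
- case E: (v 0) v0 => [|x []] //= _; case: i => [|[|i]] // _; first by rewrite psum0.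
  by rewrite (psum_block fv le_tm) ?E // /psum /= !addn0 leq_addl.
rewrite size_cat psum_cat; set N := size _ => le_i.
have [le_iN|lt_Ni] := leqP i N.
  by rewrite (leq_trans (IH t m i (ltnW le_tm) le_iN)) ?leq_addr.
rewrite (psum_oversize (ltnW lt_Ni)) -/N.
have [/(_ N (i - N)) + _] := good m; rewrite (subnKC (ltnW lt_Ni)).
move=> le_sub; apply: leq_trans le_sub _; apply: leq_add; first exact: IH (ltnW le_tm) (leqnn _).
by rewrite (psum_block fv le_tm) // leq_subLR.
Qed.

(** Shorter than the last block, a suffix of [v m] is compared with a window of
    [v m] itself, since that block is a prefix of [v m].  Otherwise it splits into
    a window as long as the last block, which sums to at most that block since
    the block is an initial window of [v m], and a shorter suffix of [v m]. *)
Lemma trunc_word_suffix_min v a t m d : block_family v -> t <= m ->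
    d <= size (trunc_word v a t) -> d <= size (v m) ->
  psum (v m) (size (v m))
      + psum (trunc_word v a t) (size (trunc_word v a t) - d)
    <= psum (trunc_word v a t) (size (trunc_word v a t))
      + psum (v m) (size (v m) - d).
Proof.
move=> fv; have [good _ v0] := fv.
elim: a t m d => [|a IH] [|t] m d le_tm; try by rewrite /= leqn0 => /eqP->; rewrite !subn0 addnC.
  case E: (v 0) v0 => [|x []] //= _; rewrite E /=; case: d => [|[|d]] // _ lt_d.
    by rewrite !subn0 addnC.
  have [/(_ (size (v m)).-1 1) + _] := good m.
  have := @psum_block _ _ _ 1 fv le_tm; rewrite E => /(_ isT) ->.
  by rewrite subnn subn1 addn1 prednK // /psum /= !addn0; lia.
rewrite /= size_cat !psum_cat addKn.
have := IH t m (d - size (v t.+1)) (ltnW le_tm).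
rewrite (@psum_oversize (trunc_word v a t) (_ + _)) ?leq_addr //.
set N := size (trunc_word _ _ _); set M := size (v m).
have leM1 := leq_size_block fv le_tm.
have eqM1 i : i <= size (v t.+1) -> psum (v t.+1) i = psum (v m) i.
  by move=> le; rewrite (psum_block fv le_tm).
move: leM1 eqM1; set M1 := size (v t.+1); rewrite -/M => leM1 eqM1 IHd le_d le_dM.
rewrite [psum (v t.+1) M1]eqM1 // [psum (v t.+1) (_ - _)]eqM1; last by rewrite -/M1; lia.
have [sub sup] := good m.
have [le_dM1|lt_M1d] := leqP d M1.
  rewrite (@psum_oversize (trunc_word v a t) (_ - _)) -/N; last lia.
  have := sup (M1 - d) M1 (M - d); rewrite -/M.
  have -> : N + M1 - d - N = M1 - d by lia.
  lia.
have := sub (M - d) M1.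
have -> : M - d + M1 = M - (d - M1) by lia.
have -> : N + M1 - d = N - (d - M1) by lia.
have -> : N - (d - M1) - N = 0 by lia.
rewrite psum0; lia.
Qed.

Lemma front_loaded_trunc_word v a t :
  block_family v -> front_loaded (trunc_word v a t).
Proof.
move=> fv; have [good _ v0] := fv.
elim: a t => [|a IH] [|t] /=; try by split=> // p q r; rewrite /psum /=.
  by case E: (v 0) v0 => [|x []] //= _; exact: front_loaded1.
apply: front_loaded_cat => // [i|d]; first exact: trunc_word_prefix_max.
exact: trunc_word_suffix_min.
Qed.

Lemma block_family_words k : block_family (words k.+1).
Proof.
elim: k => [|k IH].
  have E m : words 1 m = [:: 1].
    by elim: m => // m; rewrite -[words 1 m.+1]/(words 1 m ++ [::]) cats0.
  by split=> [m|m|]; rewrite !E //; exact: front_loaded1.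
split=> [m|m|]; first exact: front_loaded_trunc_word.
  exact: prefix_prefix.
by rewrite /= size_map; case: IH.
Qed.

(** [trunc_word] adds its blocks at the end; this peels off the first one, which
    belongs to the highest power of x_1. *)
Lemma trunc_word_cons v a t : a <= t ->
  trunc_word v a.+1 t = v (t - a) ++ trunc_word v a t.
Proof.
elim: a t => [|a IH] [|t] // le_at.
- by rewrite cats0 /= map_id.
- by rewrite cats0.
by rewrite -[trunc_word v a.+2 _]/(trunc_word v a.+1 t ++ v t.+1) IH // -catA.
Qed.

Lemma trunc_word_stable v a t : t.+1 < a -> trunc_word v a t = trunc_word v t.+2 t.
Proof.
elim: t a => [|t IH] [|a] // lt_ta /=.
  by have -> : 0 < a by lia.
by rewrite IH.
Qed.

Lemma prefix_trunc_word v a t i :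
  prefix (trunc_word v a t) (trunc_word v (a + i) (t + i)).
Proof.
elim: i => [|i IH]; first by rewrite !addn0 prefix_refl.
by rewrite !addnS; apply: prefix_trans IH (prefix_prefix _ _).
Qed.

(** The bounds [m.+2] and [m.+1] both allow the power x_1^m, but only the first
    one allows its product with x_1. *)
Lemma psum_trunc_word_top v m i : size (v 0) = 1 ->
  psum (trunc_word v m.+2 m) i = (0 < i) + psum (trunc_word v m.+1 m) i.
Proof.
move=> v0; elim: m i => [|m IH] i.
  case E: (v 0) v0 => [|x []] //= _; rewrite E /=.
  by case: i => [|i]; rewrite /psum //= !addn0.
have -> : trunc_word v m.+3 m.+1 = trunc_word v m.+2 m ++ v m.+1 by [].
have -> : trunc_word v m.+2 m.+1 = trunc_word v m.+1 m ++ v m.+1 by [].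
have eq_size : size (trunc_word v m.+2 m) = size (trunc_word v m.+1 m).
  elim: (m) => [|p IHp]; first by rewrite /= !size_map.
  by rewrite -[LHS]/(size (trunc_word v p.+2 p ++ v p.+1)) size_cat IHp -size_cat.
by rewrite !psum_cat IH eq_size -addnA.
Qed.

(** Lowering the exponent bound removes initial blocks, so that the shorter word
    is a final segment of the longer one, up to the first letter, and its
    prefixes are windows of the longer word. *)
Lemma leq_psum_trunc_word v a a' t i : block_family v -> a <= a' ->
  psum (trunc_word v a t) i <= psum (trunc_word v a' t) i.
Proof.
move=> fv; elim: a' => [|a' IH]; first by rewrite leqn0 => /eqP->.
rewrite leq_eqVlt => /predU1P[->//|/IH{IH} /leq_trans]; apply.
have [le_at|lt_ta] := leqP a' t.
  have [/(_ (size (v (t - a'))) i)] := front_loaded_trunc_word a'.+1 t fv.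
  rewrite trunc_word_cons // !psum_cat !addKn subnn psum0 addn0.
  by rewrite psum_oversize ?leq_addr // leq_add2l.
move: lt_ta; rewrite leq_eqVlt => /predU1P[<-|lt_ta].
  by rewrite psum_trunc_word_top ?leq_addl //; case: fv.
by rewrite !(@trunc_word_stable v) // ltnW.
Qed.

(** The raised first letter is counted once in the sum over [b + c] letters and
    twice on the right. *)
Lemma psum_words_lt k m b c : 0 < b -> 0 < c ->
  psum (words k.+2 m) (b + c) < psum (words k.+2 m) b + psum (words k.+2 m) c.
Proof.
move=> b_gt0 c_gt0; have fv := block_family_words k; have [_ _ v0] := fv.
have [/(_ b c) + _] := front_loaded_trunc_word m.+1 m fv.
rewrite -[words k.+2 m]/(trunc_word (words k.+1) m.+2 m) !psum_trunc_word_top //; lia.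
Qed.

Lemma size_words_double k s m : s.*2 < m ->
  (size (words k.+2 s)).*2 <= size (words k.+2 m).
Proof.
have [_ _ v0] := block_family_words k.
have leS := @leq_size_block _ _ _ (block_family_words k).
have leSS := @leq_size_block _ _ _ (block_family_words k.+1).
have S i : size (words k.+2 i.+1) = size (words k.+2 i) + size (words k.+1 i.+1).
  exact: size_cat.
have sum u w : size (words k.+2 u) + size (words k.+2 w)
    <= size (words k.+2 (u + w).+1).
  elim: w => [|w IH].
    rewrite addn0 S leq_add2l; have -> : size (words k.+2 0) = 1.
      by rewrite /= size_map.
    by rewrite -v0 leS.
  rewrite addnS [leqRHS]S S addnA leq_add // leS //; lia.
by move=> lt_sm; rewrite -addnn (leq_trans (sum s s)) // leSS // addnn.
Qed.

(** The hypothesis on [t'] says that the first block of the word for the degree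
    [t + t'] is long enough to contain two copies of the first block of the word
    for the degree [t]. *)
Lemma psum_trunc_word_lt k a t t' b c :
    0 < b -> 0 < c ->
    b <= size (trunc_word (words k.+2) a t) ->
    c <= size (trunc_word (words k.+2) a t) ->
    (a <= t.+1 -> t.+2 <= a + t') ->
  psum (trunc_word (words k.+2) a (t + t')) (b + c)
    < psum (trunc_word (words k.+2) a t) b
      + psum (trunc_word (words k.+2) a t) c.
Proof.
move=> b_gt0 c_gt0; set v := words k.+2 => le_b le_c le_t'.
have fv : block_family v := block_family_words k.+1.
have [le_at|lt_ta] := leqP a t.+1; last first.
  move: le_b le_c; rewrite (trunc_word_stable _ lt_ta) => le_b le_c.
  have := psum_words_lt k.+1 (t + t') b_gt0 c_gt0.
  rewrite -[words k.+3 _]/(trunc_word v _ _).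
  have pre := prefix_trunc_word v t.+2 t t'.
  rewrite 2!addSn in pre; rewrite (psum_prefix pre le_b) (psum_prefix pre le_c).
  move=> lt_sum; apply: leq_ltn_trans lt_sum.
  (* Without truncation the word is that of a polynomial ring with one more
     variable, and raising the bound on x_1 only increases prefix sums. *)
  pose a' := maxn a (t + t').+2.
  rewrite -(@trunc_word_stable _ a' (t + t')); last exact: leq_maxr.
  by apply: leq_psum_trunc_word => //; exact: leq_maxl.
case: a => [|a] in le_b le_c le_t' le_at *; first by rewrite leqNgt b_gt0 in le_b.
move: le_b le_c (le_t' le_at); rewrite ltnS in le_at; rewrite (trunc_word_cons v le_at).
have le_att' : a <= t + t' by rewrite (leq_trans le_at) ?leq_addr.
set s := t - a; set w := trunc_word v a t; set D := trunc_word v a.+1 _.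
rewrite !size_cat !psum_cat -(psum_minn _ b) -(psum_minn _ c).
set ls := size (v s) => le_b le_c {}le_t'.
set b1 := minn b ls; set c1 := minn c ls.
have [subD _] := front_loaded_trunc_word a.+1 (t + t') fv; rewrite -/D in subD.
(* [D] is a window, and [w] a prefix, of the same longer word. *)
have D_rest i : i <= size w -> psum D i <= psum w i.
  move=> le_i; apply: (@leq_trans (psum (trunc_word v (a + t') (t + t')) i)).
    by apply: leq_psum_trunc_word => //; lia.
  by rewrite (psum_prefix (prefix_trunc_word v a t t')).
(* The initial parts of [b] and [c] fit together into the first block of [D]. *)
have D_first : psum D (b1 + c1) < psum (v s) b1 + psum (v s) c1.
  have le_ss : s <= t + t' - a by lia.
  have le_BC : b1 + c1 <= size (v (t + t' - a)).
    have lt_sm : s.*2 < t + t' - a by rewrite /s; lia.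
    apply: leq_trans (size_words_double k lt_sm).
    by rewrite -addnn leq_add // geq_minr.
  rewrite -!(psum_block fv le_ss) ?geq_minr // /D trunc_word_cons // psum_cat.
  rewrite (eqP le_BC) psum0 addn0; apply: psum_words_lt; rewrite leq_min ?b_gt0 ?c_gt0 /=.
    by apply: leq_trans (leq_size_block fv (leq0n s)); case: fv => _ _ ->.
  by apply: leq_trans (leq_size_block fv (leq0n s)); case: fv => _ _ ->.
have := D_rest (b - ls); have := D_rest (c - ls).
have := subD (b1 + c1) (b - ls + (c - ls)); have := subD (b - ls) (c - ls).
have -> : b1 + c1 + (b - ls + (c - ls)) = b + c by lia.
lia.
Qed.

(** * Exponent sequences in decreasing lexicographic order *)

Definition incr_head (l : seq nat) : seq nat :=
  if l is x :: l' then x.+1 :: l' else [::].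

(** The list of exponent sequences whose weights form [trunc_word], built by the
    same recursion. *)
Fixpoint trunc_exps (e : nat -> seq (seq nat)) (a t : nat) : seq (seq nat) :=
  match a, t with
  | 0, _ => [::]
  | a'.+1, 0 => [seq 0 :: l | l <- e 0]
  | a'.+1, t'.+1 =>
      [seq incr_head l | l <- trunc_exps e a' t'] ++ [seq 0 :: l | l <- e t]
  end.

Fixpoint exps (k m : nat) : seq (seq nat) :=
  if k is k'.+1 then trunc_exps (exps k') m.+2 m
  else if m is 0 then [:: [::]] else [::].

Lemma mem_trunc_exps_from k e a t l :
    (forall (m : nat) l, (l \in e m) = (size l == k) && (sumn l == m)) ->
  (l \in trunc_exps e a t) = [&& size l == k.+1, sumn l == t & head 0 l < a].
Proof.
move=> mem_e; have mem0 m x l' : (x :: l' \in [seq 0 :: l0 | l0 <- e m])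
    = [&& x == 0, size l' == k & sumn l' == m].
  apply/mapP/and3P => [[l0 + [-> ->]]|[/eqP-> sz sm]]; last first.
    by exists l' => //; rewrite mem_e sz.
  by rewrite mem_e => /andP[].
have memnil m : ([::] \in [seq 0 :: l0 | l0 <- e m]) = false by apply/mapP => -[].
elim: a t l => [|a IH] [|t] [|x l] //=; try by rewrite ltn0 !andbF.
- by rewrite mem0 eqSS addn_eq0 ltnS; case: x => [|x]; rewrite ?leq0n ?andbT //= andbF.
- by rewrite mem_cat memnil orbF; apply/mapP => -[[|? ?]] //; rewrite IH.
rewrite mem_cat mem0 eqSS ltnS; case: x => [|x]; rewrite /= ?orbF.
  rewrite add0n leq0n andbT; case: mapP => // -[[|? ?]] //; by rewrite IH.
transitivity (x :: l \in trunc_exps e a t); last by rewrite IH /= eqSS.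
apply/mapP/idP => [[[|y l0] // ml0 [-> ->]] //|]; by exists (x :: l).
Qed.

Lemma mem_exps k m l : (l \in exps k m) = (size l == k) && (sumn l == m).
Proof.
elim: k m l => [|k IH] m l; first by case: m l => [|m] [|x l].
rewrite -[exps k.+1 m]/(trunc_exps (exps k) m.+2 m) (mem_trunc_exps_from _ _ _ IH); case: eqP => //= _.
case: eqP => //= <-; case: l => //= x l; lia.
Qed.

Lemma mem_trunc_exps k a t l : (l \in trunc_exps (exps k) a t)
  = [&& size l == k.+1, sumn l == t & head 0 l < a].
Proof. exact/mem_trunc_exps_from/mem_exps. Qed.

Lemma sorted_trunc_exps_from (k : nat) (e : nat -> seq (seq nat)) a t :
    (forall (m : nat) l, (l \in e m) = (size l == k) && (sumn l == m)) ->
    (forall m, sorted >%O (e m)) ->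
  sorted >%O (trunc_exps e a t).
Proof.
move=> mem_e sort_e; pose gt := fun l1 l2 : seq nat => (l1 > l2)%O.
have gt_trans : transitive gt by move=> x y z; rewrite /gt => h1 h2; apply: lt_trans h2 h1.
have sort0 m : pairwise gt [seq 0 :: l | l <- e m].
  rewrite pairwise_map; apply: (@sub_pairwise _ gt) => [l1 l2|].
    by rewrite /gt /= ltxi_cons lexx.
  by rewrite -(sorted_pairwise gt_trans); apply: sort_e.
rewrite (sorted_pairwise gt_trans).
elim: a t => [|a IH] [|t] //=.
rewrite pairwise_cat sort0 andbT; apply/andP; split; last first.
  by rewrite pairwise_map; apply: (@sub_pairwise _ gt) => // -[|x1 l1] [|x2 l2].
apply/allrelP=> l1 l2 /mapP[[|x l] + ->] /mapP[l0 _ ->].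
  by rewrite (mem_trunc_exps_from _ _ _ mem_e).
by rewrite /gt /= ltxi_cons.
Qed.

Lemma sorted_exps k m : sorted >%O (exps k m).
Proof.
elim: k m => [|k IH] m; first by case: m.
exact: (sorted_trunc_exps_from _ _ (@mem_exps k) IH).
Qed.

(** The number of variables that are not followed by another variable of the
    monomial, that is, of multipliers that become the last variable. *)
Fixpoint free_weight (l : seq nat) : nat :=
  if l is x :: l' then all (pred1 0) l' + free_weight l' else 0.

(** The same count, except that the first variable is a multiplier only if its
    exponent stays below [a]. *)
Definition weight (a : nat) (l : seq nat) : nat :=
  (all (pred1 0) (behead l) && ((head 0 l).+1 < a)) + free_weight (behead l).

Lemma weight_trunc_exps_from (k : nat) (e : nat -> seq (seq nat)) v a t :
    (forall (m : nat) l, (l \in e m) = (size l == k) && (sumn l == m)) ->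
    (forall m, [seq free_weight l | l <- e m] = v m) ->
  [seq weight a l | l <- trunc_exps e a t] = trunc_word v a t.
Proof.
move=> mem_e wt_e.
have all0 l : all (pred1 0) l = (sumn l == 0).
  by elim: l => //= x l ->; rewrite addn_eq0.
elim: a t => [|a IH] [|t] //=.
  rewrite -wt_e -!map_comp; apply/eq_in_map => l; rewrite mem_e => /andP[_ sm].
  by rewrite /= /weight /= all0 sm.
rewrite map_cat -wt_e -IH -!map_comp; congr (_ ++ _); apply/eq_in_map => l /=.
  by rewrite (mem_trunc_exps_from _ _ _ mem_e); case: l.
by rewrite mem_e => /andP[_ /eqP sm]; rewrite /weight /= all0 sm.
Qed.

Lemma free_weight_exps k m : [seq free_weight l | l <- exps k m] = words k m.
Proof.
elim: k m => [|k IH] m; first by case: m.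
rewrite -[words k.+1 m]/(trunc_word (words k) m.+2 m).
rewrite -(weight_trunc_exps_from _ _ (@mem_exps k) IH).
apply/eq_in_map => l; rewrite mem_trunc_exps => /and3P[sz /eqP sm _].
case: l sz sm => //= x l _ sm; rewrite /weight /= (_ : x.+1 < m.+2) ?andbT //; lia.
Qed.

Lemma weight_trunc_exps k a t :
  [seq weight a l | l <- trunc_exps (exps k) a t] = trunc_word (words k) a t.
Proof. exact: (weight_trunc_exps_from _ _ (@mem_exps k) (@free_weight_exps k)). Qed.

(** * Growth as a prefix sum of weights *)

Lemma mdeg_sumn n (m : 'X_{1..n}) : mdeg m = sumn m.
Proof. by rewrite mdegE sumnE big_tuple; apply: eq_bigr => i _; rewrite mnm_tnth. Qed.

Lemma mnm_ord0 n (m : 'X_{1..n.+1}) : m ord0 = head 0 m.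
Proof. by rewrite (mnm_nth 0) nth0. Qed.

Definition sorted_monomials (F : fieldType) (n a t : nat) : seq 'X_{1..n.+1} :=
  sort >=%O (monomials_in_R F n a t).

Lemma mem_sorted_monomials (F : fieldType) n a t (m : 'X_{1..n.+1}) :
  (m \in sorted_monomials F n a t) = (mdeg m == t) && (m ord0 < a).
Proof. by rewrite mem_sort in_monomials_in_R nonzero_in_RE. Qed.

Lemma sorted_monomials_uniq (F : fieldType) n a t :
  uniq (sorted_monomials F n a t).
Proof. by rewrite sort_uniq fset_uniq. Qed.

Lemma sorted_monomialsE (F : fieldType) n a t :
  [seq (m : seq nat) | m : 'X_{1..n.+1} <- sorted_monomials F n a t] = trunc_exps (exps n) a t.
Proof.
pose gt := fun l1 l2 : seq nat => (l1 > l2)%O.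
apply: (@irr_sorted_eq _ gt).
- by move=> x y z; rewrite /gt => h1 h2; apply: lt_trans h2 h1.
- by move=> x; rewrite /gt ltxx.
- pose gtm := fun m1 m2 : 'X_{1..n.+1} => (m1 > m2)%O.
  have gtm_trans : transitive gtm.
    by move=> x y z; rewrite /gtm => h1 h2; apply: lt_trans h2 h1.
  rewrite sorted_map.
  apply: (@sub_in_sorted _ [pred m in sorted_monomials F n a t] gtm).
  + move=> m1 m2; rewrite !inE !mem_sorted_monomials => /andP[/eqP d1 _] /andP[/eqP d2 _].
    by rewrite /gtm /gt /= ltEmnm d1 d2 ltxi_cons lexx.
  + exact/allP.
  + exact: (Defs.s_sorted F n a t).
- exact: sorted_trunc_exps_from (@mem_exps n) (@sorted_exps n).
move=> l; rewrite mem_trunc_exps; apply/mapP/and3P.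
  case=> m; rewrite mem_sorted_monomials => /andP[/eqP <- lt_ma] ->.
  by rewrite size_tuple mdeg_sumn -mnm_ord0.
case=> sz sm hd; pose m := Multinom (Tuple sz).
exists m => //; rewrite mem_sorted_monomials mdeg_sumn mnm_ord0.
by rewrite sm.
Qed.

(** [x_i] is the last variable of [x_i m], and this product is nonzero in R. *)
Definition fresh n (a : nat) (m : 'X_{1..n.+1}) (i : 'I_n.+1) : bool :=
  [forall j : 'I_n.+1, (i < j) ==> (m j == 0)] && ((U_(i) + m)%MM ord0 < a).

Lemma count_last_vars l :
  count (fun i => all (pred1 0) (drop i.+1 l)) (iota 0 (size l)) = free_weight l.
Proof.
elim: l => //= x l <-; rewrite drop0; congr (_ + _).
by rewrite -[1]/(1 + 0) iotaDl count_map; apply: eq_count.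
Qed.

Lemma count_fresh n a (m : 'X_{1..n.+1}) : m ord0 < a ->
  count (fresh a m) (enum 'I_n.+1) = weight a m.
Proof.
move=> lt_ma; pose P i := all (pred1 0) (drop i.+1 m) && ((i == 0) + m ord0 < a).
have freshE (i : 'I_n.+1) : fresh a m i = P i.
  rewrite /fresh /P mnmDE mnm1E -[i == ord0]/(i == 0 :> nat); congr (_ && _).
  apply/forallP/(all_nthP 0) => [zero j|zero j].
    rewrite size_drop size_tuple nth_drop => lt_j.
    have lt_jn : i.+1 + j < n.+1 by lia.
    by have := zero (Ordinal lt_jn); rewrite (mnm_nth 0) /= addSn ltnS leq_addr.
  apply/implyP=> lt_ij; have := zero (j - i.+1).
  rewrite size_drop size_tuple nth_drop subnKC // -mnm_nth; apply.
  by have := ltn_ord j; lia.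
rewrite (eq_count freshE) -(count_map (@nat_of_ord n.+1) P) val_enum_ord.
have -> : iota 0 n.+1 = iota 0 (size m) by rewrite size_tuple.
rewrite /weight.
case: (m : seq nat) (mnm_ord0 m) (size_tuple m) @P {freshE} => //= x l m0 _.
rewrite m0 in lt_ma *; rewrite drop0; congr (_ + _).
rewrite -count_last_vars -[1]/(1 + 0) iotaDl count_map.
by apply: eq_count => i /=; rewrite lt_ma andbT.
Qed.

(** [i] is recovered as the index of the last variable of the product. *)
Lemma fresh_inj n a (m1 m2 : 'X_{1..n.+1}) i1 i2 : fresh a m1 i1 -> fresh a m2 i2 ->
  (U_(i1) + m1 = U_(i2) + m2)%MM -> i1 = i2 /\ m1 = m2.
Proof.
move=> /andP[/forallP z1 _] /andP[/forallP z2 _] E.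
have eq_i : i1 = i2.
  have [lt|lt|/val_inj//] := ltngtP i1 i2.
    have := implyP (z1 i2) lt; have /mnmP/(_ i2) := E.
    by rewrite !mnmDE !mnm1E eqxx -val_eqE (ltn_eqF lt) add0n => ->.
  have := implyP (z2 i1) lt; have /mnmP/(_ i1) := E.
  by rewrite !mnmDE !mnm1E eqxx -val_eqE (ltn_eqF lt) add0n => <-.
by split=> //; move: E; rewrite eq_i => /addmI.
Qed.

(** Factor out the last variable [x_j] of [x_i m] instead of [x_i]: the cofactor
    is [m] or a larger monomial, hence still in the lexsegment set. *)
Lemma fresh_factor (F : fieldType) n a t (L : {fset 'X_{1..n.+1}}) i m :
    lexsegment F a t L -> m \in L -> (U_(i) + m)%MM ord0 < a ->
  exists j m', [/\ m' \in L, fresh a m' j & (U_(i) + m = U_(j) + m')%MM].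
Proof.
move=> [LR Lup] mL; set u := (U_(i) + m)%MM => lt_ua.
have ui : 0 < u i by rewrite mnmDE mnm1E eqxx.
pose j := [arg max_(j > i | 0 < u j) (j : nat)].
have [uj maxj] : 0 < u j /\ forall k, 0 < u k -> k <= j.
  by rewrite /j; case: arg_maxnP => // k uk maxk; split.
have le_Uu : (U_(j) <= u)%MM.
  by apply/mnm_lepP => k; rewrite mnm1E; case: eqP => [<-|].
have fr : fresh a (u - U_(j))%MM j.
  rewrite /fresh addmC submK // lt_ua andbT; apply/forallP => k.
  apply/implyP => lt_jk; rewrite mnmBE.
  by case: posnP (maxj k) => [->//|_ /(_ isT)]; rewrite leqNgt lt_jk.
exists j, (u - U_(j))%MM; split=> //; last by rewrite addmC submK.
have [eq_ij|ne_ij] := eqVneq i j; first by rewrite -eq_ij /u addmC addmK.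
have lt_ij : i < j.
  by rewrite ltn_neqAle maxj // andbT; apply: contra ne_ij => /eqP/val_inj->.
have mdm : mdeg (u - U_(j))%MM = mdeg m.
  by apply: (@addIn 1); rewrite -[1](mdeg1 j) -mdegD submK // mdegD !mdeg1 addnC.
have mR := fsubsetP LR _ mL; move: (mR); rewrite in_monomials_in_R => /andP[/eqP dm _].
apply: Lup mL _ _.
  rewrite in_monomials_in_R mdm dm eqxx nonzero_in_RE mnmBE.
  by rewrite (leq_ltn_trans (leq_subr _ _)).
apply/ltmcP => //; exists i => [k lt_ki|].
  by rewrite mnmBE mnmDE !mnm1E -!val_eqE (gtn_eqF lt_ki) (gtn_eqF (ltn_trans lt_ki lt_ij)) subn0.
by rewrite mnmBE mnmDE !mnm1E eqxx -val_eqE (gtn_eqF lt_ij) subn0.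
Qed.

(** By [fresh_factor] and [fresh_inj], R_1 . L is in bijection with the fresh
    pairs over L. *)
Lemma growthE (F : fieldType) n a t d : d <= #|` monomials_in_R F n a t| ->
  growth F n a t d = psum (trunc_word (words n) a t) d.
Proof.
move=> le_d; have [lexL _] := lexseg_ofP le_d; set L := lexseg_of _ _ _ _ _ in lexL.
have sR m : m \in take d (sorted_monomials F n a t) -> m ord0 < a.
  by move/mem_take; rewrite mem_sorted_monomials => /andP[].
pose fr m := [seq i <- enum 'I_n.+1 | fresh a m i].
pose us := [seq (U_(i) + m)%MM
  | m : 'X_{1..n.+1} <- take d (sorted_monomials F n a t), i <- fr m].
have uniq_us : uniq us.
  apply: allpairs_uniq_dep => [|m _|u1 u2].
  - by rewrite take_uniq ?sorted_monomials_uniq.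
  - by rewrite filter_uniq ?enum_uniq.
  case/allpairsPdep=> m1 [i1 [_ + ->]] /allpairsPdep[m2 [i2 [_ + ->]]] /=.
  rewrite !mem_filter => /andP[fr1 _] /andP[fr2 _] E.
  by have [-> ->] := fresh_inj fr1 fr2 E.
have memL m : (m \in L) = (m \in take d (sorted_monomials F n a t)) by rewrite !inE.
have -> : growth F n a t d = size us.
  rewrite -(undup_id uniq_us) -(card_fseq us); congr #|` _|; apply/fsetP => u.
  rewrite !inE; apply/andP/allpairsPdep.
    case=> /imfset2P[i _ [m mL ->]]; rewrite nonzero_in_RE => lt_a.
    have [j [m' [m'L frj ->]]] := fresh_factor lexL mL lt_a.
    by exists m', j; rewrite -memL mem_filter frj mem_enum.
  case=> m [i [mL + ->]]; rewrite mem_filter nonzero_in_RE => /andP[/andP[_ ->] _].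
  by split=> //; apply/imfset2P; exists i => //; exists m => //; rewrite memL.
rewrite size_allpairs_dep /psum -weight_trunc_exps -(sorted_monomialsE F).
rewrite -!map_take -map_comp; congr sumn; apply/eq_in_map => m /sR lt_ma /=.
by rewrite size_filter count_fresh.
Qed.

Lemma card_monomials_in_R (F : fieldType) n a t :
  #|` monomials_in_R F n a t| = size (trunc_word (words n) a t).
Proof.
by rewrite -weight_trunc_exps -(sorted_monomialsE F) !size_map size_sort.
Qed.

Theorem proposition8 (F : fieldType) (n a t : nat)
    (L1 L2 : {fset 'X_{1..n.+1}}) (b c j1 j2 : nat)
    (hn : 3 <= n.+1) (ha : 1 <= a)
    (hL1 : lexsegment F a t L1) (hL2 : lexsegment F a t L2)
    (hL1ne : L1 != fset0) (hL2ne : L2 != fset0)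
    (hb : #|` L1| = b) (hc : #|` L2| = c) (hbc : c <= b)
    (hj1 : is_I L1 j1) (hj2 : is_I L2 j2) :
  let t' :=
    if [&& j1 == j2, j1 != a - 1
         & (U_(ord0) *+ j1 + U_(ord_max) *+ (t - j1))%MM \notin (L1 `|` L2)%fset]
    then t - j2 else t + 1 - j2 in
  b + c <= #|` monomials_in_R F n a (t + t')| ->
  growth F n a (t + t') (b + c) < growth F n a t b + growth F n a t c.
Proof.
set t' := (X in let _ := X in _) => /= le_bc.
have [[sub1 _] [sub2 _]] := (hL1, hL2).
have le_b : b <= #|` monomials_in_R F n a t| by rewrite -hb fsubset_leq_card.
have le_c : c <= #|` monomials_in_R F n a t| by rewrite -hc fsubset_leq_card.
have b_gt0 : 0 < b by rewrite -hb cardfs_gt0.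
have c_gt0 : 0 < c by rewrite -hc cardfs_gt0.
have lt_j2a : j2 < a.
  have [[m [mL le_j _]] _] := hj2.
  have := fsubsetP sub2 _ mL; rewrite in_monomials_in_R nonzero_in_RE => /andP[_].
  by apply: leq_ltn_trans; have /mnm_lepP/(_ ord0) := le_j; rewrite mulmnE mnm1E mul1n.
(* If [t' = t - j2], then [j2 <= a - 2]; otherwise [t' = t + 1 - j2] with
   [j2 <= a - 1]. *)
have le_t' : a <= t.+1 -> t.+2 <= a + t'.
  by rewrite /t'; case: ifP => [/and3P[/eqP eq_j ne_j _]|_]; lia.
rewrite !growthE //; rewrite !card_monomials_in_R in le_b le_c.
have eq_n : n = n.-2.+2 by lia.
by move: le_b le_c; rewrite eq_n => le_b le_c; apply: psum_trunc_word_lt.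
Qed.
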